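(* Let $p,q\ge 1$ be coprime integers and let $S$ be the set of pairs $(\alpha,\beta)\in\mathbb{R}^2$ such that $\lfloor \alpha \lfloor \beta x\rfloor\rfloor \ge \lfloor \beta \lfloor \alpha x\rfloor\rfloor$ for all $x\in\mathbb{R}$. For each integer $r\ge 1$ define $$\Phi_p^r(\beta):=\frac{r\beta}{(1-r)p\beta+1}.$$ Then $\Phi_p^r$ maps the set $\{\beta<0 : (-\tfrac qp,\beta)\in S\}$ into itself; that is, if $\beta<0$ and $(-\frac qp,\beta)\in S$, then $\Phi_p^r(\beta)<0$ and $(-\frac qp,\Phi_p^r(\beta))\in S$.
   Context: $\lfloor x\rfloor$ denotes the floor function (largest integer $\le x$). *)

(* Defs.v *)
From mathcomp Require Import all_boot all_order all_algebra.
From mathcomp Require Import boolp classical_sets reals.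

Set Implicit Arguments.
Unset Strict Implicit.
Unset Printing Implicit Defensive.

Import Order.TTheory GRing.Theory Num.Theory.

Local Open Scope classical_set_scope.
Local Open Scope ring_scope.

Definition floorS {R : realType} : set (R * R) :=
  [set ab | forall x : R,
     Num.floor (ab.1 * (Num.floor (ab.2 * x))%:~R) >=
     Num.floor (ab.2 * (Num.floor (ab.1 * x))%:~R)].

(* The denominator is at least 1 when beta < 0 and r >= 1, so on the domain
   of interest the convention 0^-1 = 0 plays no role. *)
Definition Phi (R : realType) (p r : nat) (beta : R) : R :=
  (r%:R * beta) / ((1 - r%:R) * p%:R * beta + 1).

(* Main.v *)
(** Membership of [(alpha, beta)] in [S], for negative [alpha] and [beta], says
    that whenever a multiple [alpha * j] lies strictly below an integer [n],
    some multiple of [beta] lies in [[alpha * j, n[].  For [alpha = - q / p],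
    put [u := - 1 / beta - p]; the map [Phi p r] replaces [u] by [u / r], and
    with [d := p * n + q * j >= 1] the criterion asks for an integer in
    [[u (n - d / p), u n + d[].  If [k] is one for [u], then the ceiling of
    [k / r] is one for [u / r], because rounding costs at most
    [r - 1 <= (r - 1) * d]. *)
Require Import Defs.
From mathcomp Require Import all_boot all_order all_algebra.
From mathcomp Require Import boolp classical_sets reals.
From mathcomp Require Import ring lra zify.

Import Order.TTheory GRing.Theory Num.Theory.

Local Open Scope ring_scope.

(** A failure of the floor inequality at [x] amounts to an interval [[alpha * j, n[] free of
    multiples of [beta], with [j] the floor of [beta * x]. *)
Lemma floorS_negP (R : realType) (alpha beta : R) :
  alpha < 0 -> beta < 0 ->
  floorS (alpha, beta) <->
  (forall j n : int, alpha * j%:~R < n%:~R ->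
     exists k : int, alpha * j%:~R <= beta * k%:~R < n%:~R).
Proof.
move=> a0 b0; split=> [S j n ajn|H x /=].
  (* As [beta < 0], this [k] gives the largest multiple of [beta] below [n]. Were it below
     [alpha * j], the inequality would fail at [x = j / beta]. *)
  pose k : int := Num.floor (n%:~R / beta) + 1.
  have kgt : n%:~R / beta < k%:~R by rewrite floorD1_gt.
  have kle : (k - 1)%:~R <= n%:~R / beta by rewrite /k addrK floor_le.
  exists k; apply/andP; split; last by rewrite -ltr_ndivrMl// mulrC.
  rewrite leNgt; apply/negP => bkaj.
  have bx : beta * (j%:~R / beta) = j%:~R by field; rewrite lt_eqF.
  have /= := S (j%:~R / beta).
  rewrite bx intrKfloor leNgt => /negP; apply.
  apply: (@lt_le_trans _ _ n).
    by rewrite floor_lt_int.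
  rewrite floor_ge_int.
  have le1 : (Num.floor (alpha * (j%:~R / beta)) <= k - 1)%R.
    suff : (Num.floor (alpha * (j%:~R / beta)) < k)%R by lia.
    by rewrite floor_lt_int mulrA ltr_ndivrMr// mulrC.
  have : (Num.floor (alpha * (j%:~R / beta)))%:~R <= n%:~R / beta.
    by apply: le_trans kle; rewrite ler_int.
  by rewrite ler_ndivlMr// mulrC.
rewrite leNgt; apply/negP.
set j := Num.floor (beta * x); set m := Num.floor (alpha * x).
set n := Num.floor (beta * m%:~R).
(* Here [k > m] forces [k > alpha * x], so [beta * k < alpha * beta * x <= alpha * j]. *)
rewrite floor_lt_int => /H[k /andP[ajbk bkn]].
have nbm : n%:~R <= beta * m%:~R by apply: floor_le.
have mk : (m + 1 <= k)%R.
  have : beta * k%:~R < beta * m%:~R by exact: lt_le_trans nbm.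
  by rewrite ltr_nM2l// ltr_int; lia.
have axk : alpha * x < k%:~R.
  by apply: (lt_le_trans (floorD1_gt _)); rewrite ler_int.
have jbx : j%:~R <= beta * x by apply: floor_le.
have : alpha * (beta * x) <= alpha * j%:~R by rewrite ler_nM2l.
have : beta * k%:~R < beta * (alpha * x) by rewrite ltr_nM2l.
lra.
Qed.

Theorem theorem1p4 (R : realType) (p q : nat) (hp : (1 <= p)%N)
    (hq : (1 <= q)%N) (hpq : coprime p q) (r : nat) (hr : (1 <= r)%N)
    (beta : R) (hbeta : beta < 0) (hS : floorS (- (q%:R / p%:R), beta)) :
  Phi p r beta < 0 /\ floorS (- (q%:R / p%:R), Phi p r beta).
Proof.
have p0 : 0 < p%:R :> R by rewrite ltr0n.
have q0 : 0 < q%:R :> R by rewrite ltr0n.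
have r1 : 1 <= r%:R :> R by rewrite ler1n.
have D0 : 0 < (1 - r%:R) * p%:R * beta + 1 :> R.
  by rewrite ltr_wpDl// -mulrA mulr_le0 ?subr_le0// pmulr_rle0// ltW.
have Phi0 : Phi p r beta < 0.
  by rewrite /Phi pmulr_llt0 ?invr_gt0// pmulr_rlt0// (lt_le_trans ltr01).
have alpha0 : - (q%:R / p%:R) < 0 :> R by rewrite oppr_lt0 divr_gt0.
split=> //; apply/floorS_negP => // j n ajn.
have [k /andP[ajk kn]] := (floorS_negP _ _ _ alpha0 hbeta).1 hS j n ajn.
have pa : p%:R * (- (q%:R / p%:R)) = - q%:R :> R by field; rewrite gt_eqF.
move: (- (q%:R / p%:R)) pa alpha0 ajn ajk {hS} => alpha pa alpha0 ajn ajk.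
(* The integer in the criterion for [u] is [q * j - k]; its quotient by [r] has ceiling [- e], and
   [f] is the rounding cost. *)
pose e := ((k - q%:Z * j) %/ r%:Z)%Z; pose f := ((k - q%:Z * j) %% r%:Z)%Z.
have kE : k%:~R = q%:R * j%:~R + e%:~R * r%:R + f%:~R :> R.
  have -> : k = q%:Z * j + e * r%:Z + f by rewrite -addrA -divz_eq; lia.
  by rewrite !(rmorphD, rmorphM).
have f0 : 0 <= f%:~R :> R by rewrite ler0z modz_ge0; lia.
have fr : f%:~R <= r%:R - 1 :> R.
  have : (f < r%:Z)%R by rewrite ltz_pmod; lia.
  by rewrite -lezD1 -(ler_int R) rmorphD /= lerBrDr.
have d1 : 1 <= p%:R * n%:~R + q%:R * j%:~R :> R.
  have -> : p%:R * n%:~R + q%:R * j%:~R = (p%:Z * n + q%:Z * j)%:~R :> R.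
    by rewrite !(rmorphD, rmorphM).
  rewrite ler1z -gtz0_ge1 -(ltr0z R) !(rmorphD, rmorphM)/= -!pmulrn.
  have : p%:R * (alpha * j%:~R) < p%:R * n%:~R by rewrite ltr_pM2l.
  by rewrite mulrA pa; lra.
have KE : r%:R * beta * (q%:Z * j + e)%:~R =
    beta * k%:~R + (r%:R - 1) * (q%:R * j%:~R) * beta - f%:~R * beta.
  by rewrite kE !(rmorphD, rmorphM)/= -!pmulrn; ring.
exists (q%:Z * j + e).
rewrite /Phi mulrAC ler_pdivlMr// ltr_pdivrMr// KE; apply/andP; split.
  (* As [p * alpha = - q], this bound reduces to [alpha * j <= beta * k - f * beta]. *)
  have -> : alpha * j%:~R * ((1 - r%:R) * p%:R * beta + 1) =
      alpha * j%:~R - (r%:R - 1) * (p%:R * alpha) * j%:~R * beta by ring.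
  by rewrite pa; nra.
(* The rounding cost is absorbed because [d >= 1]. *)
have : f%:~R <= (r%:R - 1) * (p%:R * n%:~R + q%:R * j%:~R) :> R by nra.
by nra.
Qed.
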